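(* Let $Y$ be a $T_1$ space, and denote by $C(Y)$ the lattice of all closed subsets of $Y$ ordered by inclusion. If $\sigma(C(Y))=\upsilon(C(Y))$, then $Y$ has the discrete topology.
   Context: $C(Y)$ includes the empty set. $\sigma(C(Y))$ is the Scott topology of the complete lattice $C(Y)$: its closed sets are the lower sets closed under suprema of directed subsets. $\upsilon(C(Y))$ is the lower Vietoris topology on $C(Y)$, generated by the subbase of sets $\Diamond U=\{A\in C(Y): A\cap U\neq\emptyset\}$, where $U$ ranges over the open subsets of $Y$. *)

(* Defs.v *)
From HB Require Import structures.
From mathcomp Require Import all_boot all_order.
From mathcomp Require Import all_classical.
From mathcomp Require Import topology_structure separation_axioms.

Set Implicit Arguments.
Unset Strict Implicit.
Unset Printing Implicit Defensive.

Import Order.TTheory.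

Local Open Scope order_scope.
Local Open Scope classical_set_scope.

Section ScottTopology.
Context {d : Order.disp_t} {L : porderType d}.
Implicit Types (A D : set L) (x y z : L).

Definition directed_set D :=
  D !=set0 /\ forall x y, D x -> D y -> exists2 z, D z & x <= z /\ y <= z.

Definition lower_set A := forall x y, A y -> x <= y -> A x.

Definition scott_closed A :=
  lower_set A /\
  forall D, directed_set D -> D `<=` A -> supremums D `<=` A.

Definition scott_open A := scott_closed (~` A).

Lemma scott_openT : scott_open setT.
Proof.
by rewrite /scott_open setCT; split=> // D [[x Dx] _] /(_ x Dx).
Qed.

Lemma scott_openI : setI_closed scott_open.
Proof.
move=> A B [lA sA] [lB sB]; rewrite /scott_open setCI; split.
  by move=> x y [Ay|By] xy; [left; exact: lA Ay xy|right; exact: lB By xy].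
move=> D [D0 dirD] DAB x supx.
have lub z : (forall y, D y -> exists2 w, D w & y <= w /\ (w <= z)) -> x <= z.
  move=> h; case: supx => _ /(_ z); apply=> y /h [w _ [yw wz]].
  exact: le_trans yw wz.
(* either the members of D outside A are cofinal, or those outside B are *)
have cof (P : set L) (lP : lower_set P)
    (sP : forall E, directed_set E -> E `<=` P -> supremums E `<=` P) :
    (forall y, D y -> exists2 w, D w /\ P w & y <= w) -> P x.
  move=> cofP; apply: (sP (D `&` P)); last 2 first.
  - by move=> y [].
  - split=> [y [Dy _]|z ubz]; first by case: supx => + _; exact.
    apply: lub => y /cofP [w [Dw Pw] yw]; exists w => //; split=> //.
    exact: ubz.
  split; first by case: D0 => y /cofP [w ? _]; exists w.
  move=> y z [Dy _] [Dz _]; have [w Dw [yw zw]] := dirD _ _ Dy Dz.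
  have [v DPv wv] := cofP _ Dw; exists v => //.
  by split; apply: le_trans wv.
have [cA|/existsNP[y /not_implyP[Dy ny]]] :=
  pselect (forall y, D y -> exists2 w, D w /\ (~` A) w & y <= w).
  by left; exact: cof cA.
right; apply: (cof _ lB sB) => z Dz; have [w Dw [yw zw]] := dirD _ _ Dy Dz.
exists w => //; split=> //; case: (DAB w Dw) => // nAw.
by exfalso; apply: ny; exists w.
Qed.

Lemma scott_open_bigcup (I : Type) (f : I -> set L) :
  (forall i, scott_open (f i)) -> scott_open (\bigcup_i f i).
Proof.
move=> of_; rewrite /scott_open setC_bigcup; split.
  by move=> x y fy xy i _; case: (of_ i) => + _; apply; [exact: fy|].
move=> D dirD Df x supx i _; case: (of_ i) => _ /(_ D dirD); apply=> //.
by move=> y /Df; exact.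
Qed.

End ScottTopology.

Definition scott (T : Type) : Type := T.

HB.instance Definition _ (d : Order.disp_t) (L : porderType d) :=
  Choice.copy (scott L) L.
HB.instance Definition _ (d : Order.disp_t) (L : porderType d) :=
  isOpenTopological.Build (scott L)
    (@scott_openT d L) (@scott_openI d L) (@scott_open_bigcup d L).

Definition scott_topology (d : Order.disp_t) (L : porderType d) : set_system L :=
  @open (scott L).
Arguments scott_topology {d} L _.

Lemma scott_topologyE (d : Order.disp_t) (L : porderType d) :
  scott_topology L = scott_open.
Proof. by []. Qed.

Section ClosedSets.
Variable Y : topologicalType.

Definition closedp : {pred set Y} := fun A => `[< closed A >].

Lemma closedpP A : reflect (closed A) (A \in closedp).
Proof. exact: asboolP. Qed.

Lemma closedpI : {in closedp &, forall A B, (A `&` B)%O \in closedp}.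
Proof.
by move=> A B /closedpP cA /closedpP cB; apply/closedpP; exact: closedI.
Qed.

Lemma closedpU : {in closedp &, forall A B, (A `|` B)%O \in closedp}.
Proof.
by move=> A B /closedpP cA /closedpP cB; apply/closedpP; exact: closedU.
Qed.

Lemma closedp0 : \bot \in closedp. Proof. exact/closedpP/closed0. Qed.

Lemma closedpT : \top \in closedp. Proof. exact/closedpP/closedT. Qed.

HB.instance Definition _ := Order.isTBLatticeClosed.Build set_display (set Y)
  closedp closedpI closedpU closedp0 closedpT.

Record closed_set := ClosedSet {
  closed_set_val :> set Y; closed_setP : closed_set_val \in closedp }.

HB.instance Definition _ := [isSub for closed_set_val].
HB.instance Definition _ := [Choice of closed_set by <:].
HB.instance Definition _ :=
  [SubChoice_isTBSubLattice of closed_set by <: with set_display].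

Lemma closed_set_closed (A : closed_set) : closed A.
Proof. exact/closedpP/closed_setP. Qed.

Lemma closed_set_le (A B : closed_set) :
  (A <= B) = ((A : set Y) `<=` (B : set Y)) :> Prop.
Proof. exact: subsetEset. Qed.

(* In particular the lattice of closed sets is complete. *)
Lemma closed_set_supremums (F : set closed_set) (S : closed_set) :
  supremums F S <-> S = closure (\bigcup_(A in F) A) :> set Y.
Proof.
set K := closure _.
have Kp : K \in closedp by apply/closedpP/closed_closure.
have ubK : ubound F (ClosedSet Kp).
  move=> A FA; rewrite closed_set_le => y Ay.
  by apply: subset_closure; exists A.
have lubK (B : closed_set) : ubound F B -> K `<=` B.
  move=> ubB; have -> : B = closure B :> set Y.
    by apply/closure_id; exact: closed_set_closed.
  apply: closureS => y [A FA Ay].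
  by have := ubB _ FA; rewrite closed_set_le; exact.
split=> [[ubS lubS]|SK].
  rewrite eqEsubset; split; last exact: lubK.
  by have := lubS _ ubK; rewrite closed_set_le.
have -> : S = ClosedSet Kp by apply: val_inj.
by split=> // B /lubK; rewrite -(closed_set_le (ClosedSet Kp)).
Qed.

Definition diamond (U : set Y) : set closed_set :=
  [set A : closed_set | (A : set Y) `&` U !=set0].

Definition lower_vietoris : Type := closed_set.

HB.instance Definition _ := Choice.copy lower_vietoris closed_set.
HB.instance Definition _ :=
  @isSubBaseTopological.Build lower_vietoris (set Y) open diamond.

Definition lower_vietoris_topology : set_system closed_set :=
  @open lower_vietoris.

Lemma lower_vietoris_topologyE :
  lower_vietoris_topology =
  [set \bigcup_(V in B) V | B in subset^~ (finI_from open diamond)].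
Proof. by []. Qed.

End ClosedSets.

Arguments lower_vietoris_topology Y _ : clear implicits.

(* Main.v *)
Require Import Defs.
From mathcomp Require Import all_boot all_order.
From mathcomp Require Import finmap.
From mathcomp Require Import all_classical.
From mathcomp Require Import topology_structure separation_axioms.

(** Fix a point [y].  The closed sets that avoid [y] and have at most one
    point form a Scott closed family: in a T1 space a set with at most one
    point is closed, so the supremum of a directed subfamily is just its union,
    and directedness puts any two points of that union in a single member.
    The complementary family is Scott open and contains [{y}].  A basic open
    set of the lower Vietoris topology around [{y}] is a finite intersection of
    sets [diamond U] with [y \in U]; if it lies within that complement, no point
    [x] other than [y] belongs to all these [U], for [{x}] would belong to the
    basic open set.  The intersection of the [U] is thus an open set
    equal to [{y}]. *)

Local Open Scope classical_set_scope.

Lemma closed_subsingleton {Y : topologicalType} (W : set Y) :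
  accessible_space Y -> (forall x x', W x -> W x' -> x = x') -> closed W.
Proof.
move=> T1 W1; have [->|/set0P[x Wx]] := eqVneq W set0; first exact: closed0.
have -> : W = [set x].
  by apply/seteqP; split=> [x' Wx'|_ ->//]; exact: W1.
exact: accessible_closed_set1.
Qed.

Definition closed_set1 {Y : topologicalType} (T1 : accessible_space Y) (x : Y) :
    closed_set Y :=
  ClosedSet (introT (closedpP _) (accessible_closed_set1 T1 (x := x))).

Definition subsingleton_away {Y : topologicalType} (y : Y) : set (closed_set Y) :=
  [set A | forall x x', (A : set Y) x -> (A : set Y) x' -> x = x' /\ x <> y].

(** A directed union of subsingletons is a subsingleton, hence closed in a T1
    space, so the supremum adds no point to the union; without this, the
    closure could bring [y] back in. *)
Lemma scott_closed_subsingleton_away {Y : topologicalType} (y : Y) :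
  accessible_space Y -> scott_closed (subsingleton_away y).
Proof.
move=> T1; split=> [A B PB|D [_ dirD] DP S /closed_set_supremums supS].
  by rewrite closed_set_le => AB x x' /AB Bx /AB; exact: PB.
have PW x x' : (\bigcup_(A in D) (A : set Y)) x ->
    (\bigcup_(A in D) (A : set Y)) x' -> x = x' /\ x <> y.
  move=> [A DA Ax] [B DB Bx']; have [C DC [AC BC]] := dirD _ _ DA DB.
  by move: AC BC; rewrite !closed_set_le => AC BC; apply: (DP C DC); auto.
move=> x x'; rewrite supS.
have /closure_id <- // : closed (\bigcup_(A in D) (A : set Y)).
  by apply: (closed_subsingleton _ T1) => z z' Wz Wz'; case: (PW z z').
exact: PW.
Qed.

(** Tested on singletons, a finite intersection of sets [diamond U] is the
    open set obtained by intersecting the [U]: for singletons, unlike for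
    larger sets, meeting every [U] is the same as meeting their
    intersection. *)
Lemma finI_diamond_nbhs1 {Y : topologicalType} (T1 : accessible_space Y)
    {y : Y} {V : set (closed_set Y)} :
  finI_from open (@diamond Y) V -> V (closed_set1 T1 y) ->
  exists U : set Y, [/\ open U, U y & forall x, U x -> V (closed_set1 T1 x)].
Proof.
move=> [F Fopen <-] Vy; exists (\bigcap_(U in [set` F]) U); split.
- rewrite bigcap_fset big_seq; apply: big_ind => [|U W|U /Fopen /set_mem //].
    exact: openT.
  exact: openI.
- by move=> U FU; have [_ [->]] := Vy U FU.
- by move=> x Ux U FU; exists x; split=> //; exact: Ux U FU.
Qed.

Theorem proposition3p15 (Y : topologicalType) (hT1 : accessible_space Y)
  (hsv : scott_topology (closed_set Y) = lower_vietoris_topology Y) :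
  forall A : set Y, open A.
Proof.
have open1 (y : Y) : open [set y].
  have : scott_topology (closed_set Y) (~` subsingleton_away y).
    rewrite scott_topologyE /scott_open setCK.
    exact: scott_closed_subsingleton_away.
  rewrite hsv lower_vietoris_topologyE => -[B Bfin BE].
  have : (~` subsingleton_away y) (closed_set1 hT1 y).
    by move=> /(_ y y erefl erefl) [].
  rewrite -BE => -[V BV Vy].
  have [U [oU Uy UV]] := finI_diamond_nbhs1 hT1 (Bfin _ BV) Vy.
  suff -> : [set y] = U by [].
  apply/seteqP; split=> [_ ->//|x Ux]; apply: contrapT => xy.
  have : (~` subsingleton_away y) (closed_set1 hT1 x).
    by rewrite -BE; exists V => //; exact: UV.
  by apply=> _ _ -> ->.
move=> A; rewrite (_ : A = \bigcup_(y in A) [set y]).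
  by apply: bigcup_open => y _; exact: open1.
by apply/seteqP; split=> [y Ay|_ [y Ay ->] //]; exists y.
Qed.
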